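(* Let $(M,\alpha)$ be a strict contact manifold and let $f,f',g$ be smooth real-valued functions on $M$. Then $$[ff',g]=f[f',g]+f'[f,g]-ff'[\mathbbm{1},g],$$ where $[\cdot,\cdot]$ is the Jacobi bracket and $\mathbbm{1}$ is the constant function $1$ on $M$.
   Context: A strict contact manifold $(M,\alpha)$ is a $(2n+1)$-dimensional smooth manifold $M$ with a smooth 1-form $\alpha$ such that $\alpha\wedge(d\alpha)^n$ is nowhere zero. The Reeb vector field $R_\alpha$ is the unique vector field with $\iota_{R_\alpha}d\alpha=0$ and $\alpha(R_\alpha)=1$. For a smooth function $H$ on $M$, the contact Hamiltonian vector field $X_H$ is the unique vector field with $\alpha(X_H)=H$ and $\iota_{X_H}d\alpha=dH(R_\alpha)\alpha-dH$. The Jacobi bracket is $[f,g]=\alpha([X_f,X_g])$, with $[X_f,X_g]$ the Lie bracket of vector fields. *)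

(* Defs.v *)
From HB Require Import structures.
From mathcomp Require Import all_boot all_order all_algebra all_fingroup.
From mathcomp Require Import all_classical all_reals all_analysis.

Set Implicit Arguments.
Unset Strict Implicit.
Unset Printing Implicit Defensive.

Import Order.TTheory GRing.Theory Num.Theory.
Import numFieldNormedType.Exports.

Local Open Scope classical_set_scope.
Local Open Scope ring_scope.

(* [C_on k A f]: f is of class C^k on the open set A of R^d. As R^d is finite
   dimensional, x |-> 'd f x is C^k iff x |-> 'd f x v is for every v. *)
Fixpoint C_on (R : realType) (d : nat) (V : normedModType R) (k : nat)
    (A : set 'rV[R]_d) (f : 'rV[R]_d -> V) : Prop :=
  match k with
  | 0 => forall x, A x -> {for x, continuous f}
  | k'.+1 => (forall x, A x -> differentiable f x) /\
             (forall v : 'rV[R]_d, C_on k' A (fun x => 'd f x v))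
  end.

Definition smooth_on (R : realType) (d : nat) (V : normedModType R)
    (A : set 'rV[R]_d) (f : 'rV[R]_d -> V) : Prop :=
  forall k, C_on k A f.

(* A d-dimensional smooth manifold, presented by a smooth atlas. [coord i] and
   [param i] are mutually inverse between [dom i] and its image; their values
   elsewhere are irrelevant. [chart_at p] is a preferred chart around p: it
   witnesses that the charts cover, and it is the chart in which the tangent
   space at p is identified with R^d below. *)
Record manifold (R : realType) (d : nat) := Manifold {
  point :> topologicalType;
  index : Type;
  dom : index -> set point;
  coord : index -> point -> 'rV[R]_d;
  param : index -> 'rV[R]_d -> point;
  chart_at : point -> index;
  manifold_hausdorff : hausdorff_space point;
  manifold_second_countable : @second_countable point;
  dom_open : forall i, open (dom i);
  img_open : forall i, open (coord i @` dom i);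
  coordK : forall i p, dom i p -> param i (coord i p) = p;
  coord_continuous : forall i p, dom i p -> {for p, continuous (coord i)};
  param_continuous : forall i p, dom i p ->
    {for coord i p, continuous (param i)};
  chart_atP : forall p, dom (chart_at p) p;
  transition_smooth : forall i j,
    smooth_on (coord i @` (dom i `&` dom j)) (coord j \o param i)
}.

Section Calculus.
Variables (R : realType) (d : nat) (M : manifold R d).
Implicit Types (p : M) (i j : index M) (f : M -> R).

Definition img i : set 'rV[R]_d := coord i @` dom i.

Definition smooth_fun f : Prop := forall i, smooth_on (img i) (f \o param i).

(* A tangent vector at p is given by its components in the chart [chart_at p];
   [tchange i j p] converts components at p in the chart i to components in
   the chart j. *)
Definition tchange i j p (v : 'rV[R]_d) : 'rV[R]_d :=
  'd (coord j \o param i) (coord i p) v.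

(* (Not necessarily smooth) vector fields and 1-forms: at p, the components of
   the vector, resp. the linear form on components, in [chart_at p]. *)
Definition vfield := M -> 'rV[R]_d.
Definition oneform := M -> {scalar 'rV[R]_d}.
Implicit Types (X Y : vfield) (a : oneform).

Definition vcoord X i (x : 'rV[R]_d) : 'rV[R]_d :=
  tchange (chart_at (param i x)) i (param i x) (X (param i x)).

Definition fcoord a i (x v : 'rV[R]_d) : R :=
  a (param i x) (tchange i (chart_at (param i x)) (param i x) v).

Definition smooth_vfield X : Prop :=
  forall i, smooth_on (img i) (vcoord X i).

Definition smooth_oneform a : Prop :=
  forall i v, smooth_on (img i) (fun x => fcoord a i x v).

Definition dfun f p (v : 'rV[R]_d) : R :=
  let i := chart_at p in 'd (f \o param i) (coord i p) v.

(* da(u, v) = D_u (a(v)) - D_v (a(u)), where on the right u and v are extended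
   as constant vector fields in the chart. *)
Definition dform a p (u v : 'rV[R]_d) : R :=
  let i := chart_at p in let x := coord i p in
  'd (fcoord a i ^~ v) x u - 'd (fcoord a i ^~ u) x v.

(* [X, Y] = DY . X - DX . Y in a chart, so that [X, Y] f = X (Y f) - Y (X f). *)
Definition lie X Y : vfield := fun p =>
  let i := chart_at p in let x := coord i p in
  'd (vcoord Y i) x (X p) - 'd (vcoord X i) x (Y p).

Definition pairing a X : M -> R := fun p => a p (X p).

End Calculus.

(* k-forms on R^d at a point, as functions of k vectors. *)
Definition kform (R : realType) (d k : nat) := ('I_k -> 'rV[R]_d) -> R.

Definition wedge (R : realType) (d k l : nat)
    (w : kform R d k) (h : kform R d l) : kform R d (k + l) :=
  fun v => (k`! * l`!)%:R^-1 *
    \sum_(s : 'S_(k + l)) (-1) ^+ s *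
       (w (fun i => v (s (lshift l i))) * h (fun j => v (s (rshift k j)))).

Definition form1 (R : realType) (d : nat) (a : 'rV[R]_d -> R) : kform R d 1 :=
  fun v => a (v ord0).

Definition form2 (R : realType) (d : nat) (b : 'rV[R]_d -> 'rV[R]_d -> R) :
    kform R d 2 :=
  fun v => b (v ord0) (v ord_max).

(* w ^ n for a 2-form w; the degree n.+1 * 2 is convertible to 2 + n * 2. *)
Fixpoint wedge_pow (R : realType) (d : nat) (n : nat) (w : kform R d 2) :
    kform R d (n * 2) :=
  match n with
  | 0 => fun _ => 1
  | n'.+1 => wedge w (@wedge_pow R d n' w)
  end.
Arguments wedge_pow {R d} n w.

Section Contact.
Variables (R : realType) (n : nat) (M : manifold R (2 * n).+1).
Variable alpha : oneform M.

Definition contact_form : Prop :=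
  smooth_oneform alpha /\
  forall p : M, exists v,
    wedge (form1 (alpha p)) (wedge_pow n (form2 (dform alpha p))) v != 0.

Definition is_reeb (X : vfield M) : Prop :=
  [/\ smooth_vfield X,
      forall p v, dform alpha p (X p) v = 0
    & forall p, alpha p (X p) = 1].

(* The vector field satisfying [is_reeb]; zero if there is none. *)
Definition reeb : vfield M := xget (fun=> 0) [set X | is_reeb X].

Definition is_contact_hamiltonian (H : M -> R) (X : vfield M) : Prop :=
  [/\ smooth_vfield X,
      forall p, alpha p (X p) = H p
    & forall p v, dform alpha p (X p) v =
        dfun H p (reeb p) * alpha p v - dfun H p v].

(* The vector field satisfying [is_contact_hamiltonian H]; zero if there is
   none. *)
Definition contact_hamiltonian (H : M -> R) : vfield M :=
  xget (fun=> 0) [set X | is_contact_hamiltonian H X].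

Definition jacobi (f g : M -> R) : M -> R :=
  pairing alpha (lie (contact_hamiltonian f) (contact_hamiltonian g)).

End Contact.

(* Main.v *)
Require Import Defs.
From HB Require Import structures.
From mathcomp Require Import all_boot all_order all_algebra all_fingroup.
From mathcomp Require Import all_classical all_reals all_analysis.
From mathcomp Require Import ring.
Import Defs.

(** Why the identity holds. Write R for the Reeb field and X_h for the contact
    Hamiltonian field of h. Cartan's formula
      alpha([X, Y]) = X(alpha(Y)) - Y(alpha(X)) - dalpha(X, Y),
    applied to X_f and X_g, whose pairings with alpha are f and g, together
    with dalpha(X_g, X_f) = dg(R) f - dg(X_f), gives
      [f, g] = f dg(R) - df(X_g)                       (lemma [jacobiE]).
    The second term is a derivation in f; the first is linear in f over the
    functions, and at f = 1 the bracket is dg(R). Expanding d(f f') with the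
    Leibniz rule yields the proposition.

    The bulk of the work is the existence of X_h as a smooth vector field: R
    and X_h are picked by a choice operator that returns 0 when no such field
    exists, and the fields must be smooth in every chart, not only in the one
    that represents the tangent space at the point.

    Existence goes through a musical isomorphism. The bilinear form
      B = dalpha + alpha (x) alpha
    is nondegenerate: if B(u, .) = 0 then B(u, u) = alpha(u)^2 = 0, so u lies in
    the kernel of both alpha and dalpha, and a nonzero such u would kill the top
    form alpha /\ (dalpha)^n ([metric_nondegenerate]). Hence every smooth
    1-form beta has a unique B-dual field ([sharpP]), and X_h is the dual of
    (dh(R) + h) alpha - dh once R is known. For R take the dual of alpha; that
    dalpha(R, .) = 0 then uses that the dimension is odd, so that the
    skew-symmetric form dalpha has a kernel vector ([metric_reeb]).

    Smoothness of the dual field ([smooth_sharp]) follows from Cramer's rule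
    in each chart, provided that the local formulas in the various charts
    describe the same field. This compatibility is the covariance of dalpha
    under changes of charts ([dchart_change]), which rests on the symmetry of
    the second derivatives of the transition maps ([schwarz]). *)

Set Implicit Arguments.
Unset Strict Implicit.
Unset Printing Implicit Defensive.

Import Order.TTheory GRing.Theory Num.Theory.
Import numFieldNormedType.Exports.

Local Open Scope classical_set_scope.
Local Open Scope ring_scope.

(** * Differentials and functions of class C^k *)

Section DifferentialLocality.
Variables (R : realType) (V W : normedModType R).
Implicit Types (f g : V -> W) (x : V) (A : set V).

(** The differential is defined by a choice among linear maps, so its
    locality is not a matter of unfolding: it follows from uniqueness of the
    first-order expansion. *)
Lemma near_eq_is_diff f g x : {near x, f =1 g} -> differentiable f x ->
  is_diff x g ('d f x).
Proof.
move=> fg df.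
have fgx : f x = g x := nbhs_singleton fg.
have dfc : continuous ('d f x) by exact: diff_continuous.
have expg : g \o shift x = cst (g x) + 'd f x +o_ 0 id.
  apply/eqaddoP => e e0.
  have /eqaddoP/(_ e e0) := diff_locally df.
  have : \forall y \near 0, f (y + x) = g (y + x).
    by move: fg; rewrite (near_shift 0) /= subr0.
  by apply: filterS2 => y /= fgy; rewrite !fctE /= fgy fgx.
have dg : 'd g x = 'd f x :> (V -> W) by exact: diff_unique.
have ddg : differentiable g x.
  by apply/diff_locallyP; rewrite dg; split; [exact: dfc|exact: expg].
exact: DiffDef ddg dg.
Qed.

Lemma open_eq_is_diff A f g x : open A -> A x ->
  (forall y, A y -> f y = g y) -> differentiable f x -> is_diff x g ('d f x).
Proof.
move=> oA Ax fg; apply: near_eq_is_diff.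
by apply: filterS fg _; exact: open_nbhs_nbhs.
Qed.

Lemma open_eq_diff A f g x v : open A -> A x ->
  (forall y, A y -> f y = g y) -> differentiable f x -> 'd g x v = 'd f x v.
Proof.
move=> oA Ax fg df; have [_ e] := open_eq_is_diff oA Ax fg df.
exact: (congr1 (@^~ v) e).
Qed.

End DifferentialLocality.

(** The intermediate point y is kept separate from f x, because below it
    appears as the coordinate of a point rather than as a value of f. *)
Section Chain.
Variables (R : realType) (U V W : normedModType R).
Variables (f : U -> V) (g : V -> W) (x : U) (y : V).
Hypotheses (fx : f x = y) (df : differentiable f x) (dg : differentiable g y).

Lemma chain_differentiable : differentiable (g \o f) x.
Proof. by apply: differentiable_comp => //; rewrite fx. Qed.

Lemma chain_rule v : 'd (g \o f) x v = 'd g y ('d f x v).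
Proof. by move: dg; rewrite -fx => dgx; rewrite (diff_comp df dgx). Qed.

End Chain.

Section Coordinate.
Variables (R : realType) (d : nat).

Definition entry (k : 'I_d) (v : 'rV[R]_d) : R := v 0 k.

Lemma entry_is_linear k : linear (entry k).
Proof. by move=> a u v; rewrite /entry !mxE. Qed.

HB.instance Definition _ k :=
  GRing.isLinear.Build R 'rV[R]_d R _ (entry k) (entry_is_linear k).

Lemma entry_continuous k : continuous (entry k).
Proof. exact: matrix_normedtype.coord_continuous. Qed.

Lemma linear_expand (V : lmodType R) (L : {linear 'rV[R]_d -> V}) v :
  L v = \sum_(k < d) entry k v *: L (delta_mx 0 k).
Proof.
rewrite {1}(row_sum_delta v) linear_sum; apply: eq_bigr => k _.
by rewrite linearZ.
Qed.

End Coordinate.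

Section SmoothAlgebra.
Variables (R : realType) (d : nat).
Implicit Types (V W : normedModType R) (A : set 'rV[R]_d) (k : nat).

(** The rules of differentiation give the derivative of a compound function
    only at the points of A, where its ingredients are differentiable; this
    lemma is what lets regularity be read off from such a formula. *)
Lemma C_on_ext V k A (f g : 'rV[R]_d -> V) : open A ->
  (forall x, A x -> f x = g x) -> C_on k A f -> C_on k A g.
Proof.
move=> oA; elim: k f g => [|k IH] f g fg /=.
  move=> cf x Ax; rewrite -[prop_for _ _]/(g @ x --> g x) -(fg x Ax).
  have fgx : {near x, f =1 g} by apply: filterS fg _; exact: open_nbhs_nbhs.
  exact: cvg_trans (near_eq_cvg fgx) (cf x Ax).
move=> [df Cdf].
have dg x : A x -> is_diff x g ('d f x).
  by move=> Ax; apply: open_eq_is_diff fg (df x Ax).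
split=> [x /dg|v]; first by case.
apply: IH (Cdf v) => x Ax /=.
by have [_ /(congr1 (@^~ v))/esym] := dg x Ax.
Qed.

Lemma C_onW V k A (f : 'rV[R]_d -> V) : C_on k.+1 A f -> C_on k A f.
Proof.
elim: k f => [|k IH] f [df Cdf].
  by move=> x /df; apply: differentiable_continuous.
by split=> // v; apply: IH.
Qed.

Lemma C_on_cst V k A (c : V) : open A -> C_on k A (fun=> c).
Proof.
move=> oA; elim: k c => [|k IH] c; first by move=> x _; exact: cst_continuous.
split=> [x _|v]; first exact: differentiable_cst.
apply: (@C_on_ext _ _ _ (fun=> 0)) (IH 0) => // x _.
by rewrite (@diff_cst _ _ _ c x).
Qed.

Lemma C_onD V k A (f g : 'rV[R]_d -> V) : open A ->
  C_on k A f -> C_on k A g -> C_on k A (fun x => f x + g x).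
Proof.
move=> oA; elim: k f g => [|k IH] f g.
  by move=> cf cg x Ax; apply: continuousD; [exact: cf|exact: cg].
move=> [df Cf] [dg Cg].
split=> [x Ax|v]; first exact: differentiableD (df x Ax) (dg x Ax).
apply: C_on_ext (IH _ _ (Cf v) (Cg v)) => // x Ax.
by have /(congr1 (@^~ v)) := diffD (df x Ax) (dg x Ax) => /esym.
Qed.

Lemma C_on_sum V k A (I : Type) (r : seq I) (F : I -> 'rV[R]_d -> V) :
  open A -> (forall i, C_on k A (F i)) ->
  C_on k A (fun x => \sum_(i <- r) F i x).
Proof.
move=> oA CF; elim: r => [|i r IH].
  by under eq_fun do rewrite big_nil; exact: C_on_cst.
by under eq_fun do rewrite big_cons; apply: C_onD.
Qed.

Lemma C_on_linear V W k A (L : {linear V -> W}) (f : 'rV[R]_d -> V) :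
  open A -> continuous L -> C_on k A f -> C_on k A (L \o f).
Proof.
move=> oA cL; elim: k f => [|k IH] f.
  by move=> cf x Ax; apply: continuous_comp; [exact: cf|exact: cL].
have dL y : differentiable L y := linear_differentiable y cL.
move=> [df Cf]; split=> [x Ax|v].
  exact: differentiable_comp (df x Ax) (dL _).
apply: C_on_ext (IH _ (Cf v)) => // x Ax /=.
by rewrite (diff_comp (df x Ax) (dL _)) /= diff_lin.
Qed.

Lemma C_onM k A (f g : 'rV[R]_d -> R) : open A ->
  C_on k A f -> C_on k A g -> C_on k A (fun x => f x * g x).
Proof.
move=> oA; elim: k f g => [|k IH] f g.
  by move=> cf cg x Ax; apply: continuousM; [exact: cf|exact: cg].
move=> Cf1 Cg1; have [df Cf] := Cf1; have [dg Cg] := Cg1.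
split=> [x Ax|v]; first exact: differentiableM (df x Ax) (dg x Ax).
apply: (@C_on_ext _ _ _ (fun x => f x * 'd g x v + g x * 'd f x v)) => //.
  by move=> x Ax; have /(congr1 (@^~ v)) := diffM (df x Ax) (dg x Ax) => /esym.
have Cf0 := C_onW Cf1; have Cg0 := C_onW Cg1.
exact: C_onD oA (IH _ _ Cf0 (Cg v)) (IH _ _ Cg0 (Cf v)).
Qed.

Lemma C_onB k A (f g : 'rV[R]_d -> R) : open A ->
  C_on k A f -> C_on k A g -> C_on k A (fun x => f x - g x).
Proof.
move=> oA Cf Cg; apply: (@C_on_ext _ _ _ (fun x => f x + -1 * g x)) => //.
  by move=> x _; rewrite mulN1r.
exact: C_onD oA Cf (C_onM oA (C_on_cst _ _ oA) Cg).
Qed.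

Lemma C_on_prod k A (I : Type) (r : seq I) (F : I -> 'rV[R]_d -> R) :
  open A -> (forall i, C_on k A (F i)) ->
  C_on k A (fun x => \prod_(i <- r) F i x).
Proof.
move=> oA CF; elim: r => [|i r IH].
  by under eq_fun do rewrite big_nil; exact: C_on_cst.
by under eq_fun do rewrite big_cons; apply: C_onM.
Qed.

Lemma C_onV k A (f : 'rV[R]_d -> R) : open A -> (forall x, A x -> f x != 0) ->
  C_on k A f -> C_on k A (fun x => (f x)^-1).
Proof.
move=> oA f0; elim: k => [|k IH].
  by move=> cf x Ax; apply: continuousV; [exact: f0|exact: cf].
move=> Cf1; have [df Cf] := Cf1.
have scale_inv2 (a b : R) : -1 * (a^-1 * a^-1 * b) = - a ^- 2 * b.
  by rewrite mulrA mulN1r -invfM -expr2 mulNr.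
split=> [x Ax|v]; first exact: differentiableV (df x Ax) (f0 x Ax).
apply: (@C_on_ext _ _ _ (fun x => -1 * ((f x)^-1 * (f x)^-1 * 'd f x v))) => //.
  move=> x Ax; rewrite scale_inv2; symmetry.
  have e : 'd (fun y => (f y)^-1) x v = - f x ^- 2 *: 'd f x v :=
    congr1 (@^~ v) (diffV (df x Ax) (f0 x Ax)).
  exact: e.
have /IH Cif := C_onW Cf1.
exact: C_onM oA (C_on_cst _ _ oA) (C_onM oA (C_onM oA Cif Cif) (Cf v)).
Qed.

Lemma C_on_row k A m (f : 'rV[R]_d -> 'rV[R]_m) : open A ->
  (forall j, C_on k A (fun x => f x 0 j)) -> C_on k A f.
Proof.
move=> oA Cf.
have -> : f = fun x => \sum_(j < m) (f x 0 j *: delta_mx 0 j : 'rV[R]_m).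
  by apply/funext => x; exact: row_sum_delta.
apply: C_on_sum => // j.
have sc_lin : linear ( *:%R^~ (delta_mx 0 j : 'rV[R]_m) : R -> _).
  by move=> u y z; rewrite scalerDl scalerA.
pose scM := GRing.isLinear.Build _ _ _ _ _ sc_lin.
pose sc : {linear R -> 'rV[R]_m} := HB.pack ( *:%R^~ (delta_mx 0 j)) scM.
by apply: (@C_on_linear _ _ _ _ sc) => //; exact: scalel_continuous.
Qed.

Lemma C_on_det k A m (B : 'rV[R]_d -> 'M[R]_m) : open A ->
  (forall i j, C_on k A (fun x => B x i j)) -> C_on k A (fun x => \det (B x)).
Proof.
move=> oA CB; apply: C_on_sum => // s.
by apply: C_onM => //; [exact: C_on_cst|exact: C_on_prod].
Qed.

(** Cramer's rule: the solution of a linear system is a rational function of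
    its coefficients. *)
Lemma C_on_solve k A m (b : 'rV[R]_d -> 'rV[R]_m) (B : 'rV[R]_d -> 'M[R]_m) :
  open A -> (forall x, A x -> B x \in unitmx) ->
  (forall j, C_on k A (fun x => b x 0 j)) ->
  (forall i j, C_on k A (fun x => B x i j)) ->
  C_on k A (fun x => b x *m invmx (B x)).
Proof.
move=> oA uB Cb CB; apply: C_on_row => // j.
apply: (@C_on_ext _ _ _ (fun x => \sum_l b x 0 l *
    ((\det (B x))^-1 * ((-1) ^+ (j + l) * \det (row' j (col' l (B x)))))));
  [by []| |].
  move=> x /uB uBx; rewrite mxE; apply: eq_bigr => l _.
  by rewrite /invmx uBx !mxE.
apply: C_on_sum => // l; apply: C_onM => //; apply: C_onM => //.
  apply: C_onV => //; last exact: C_on_det.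
  by move=> x /uB; rewrite unitmxE unitfE.
apply: C_onM => //; first exact: C_on_cst.
apply: C_on_det => // i i'.
by apply: C_on_ext (CB (lift j i) (lift l i')) => // x _; rewrite !mxE.
Qed.

End SmoothAlgebra.

(** * Symmetry of second derivatives *)

Section AffineMaps.
Variables (R : realType) (V : normedModType R).
Implicit Types x y u w : V.

Lemma is_diff_line y u (s : R) :
  is_diff s (fun r : R => y + r *: u) ( *:%R^~ u).
Proof.
have dl := @is_diffD R R^o V _ _ _ _ s (@is_diff_cst R R^o V y s)
  (@is_diff_scalel R V s u).
by apply: (@is_diff_eq R R^o V _ _ _ s dl); apply/funext => r; exact: add0r.
Qed.

Lemma is_diff_shift x w : is_diff x (fun y => y + w) id.
Proof.
have ds := @is_diffD R V V _ _ _ _ x (is_diff_id x) (@is_diff_cst R V V w x).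
by apply: (@is_diff_eq R V V _ _ _ x ds); apply/funext => r; exact: addr0.
Qed.

End AffineMaps.

Section Schwarz.
Variables (R : realType) (d : nat).
Implicit Types (A : set 'rV[R]_d) (h : 'rV[R]_d -> R) (x u v : 'rV[R]_d).

Lemma is_derive_line h y u s : differentiable h (y + s *: u) ->
  is_derive s 1 (fun r : R => h (y + r *: u)) ('d h (y + s *: u) u).
Proof.
move=> dh.
have dl := is_diff_line y u s.
have dhl : differentiable (h \o (fun r : R => y + r *: u)) s.
  by apply: differentiable_comp => //; apply: ex_diff.
apply: DeriveDef; first exact: diff_derivable.
rewrite (deriveE _ dhl) (diff_comp (ex_diff (is_diff_def := dl)) dh) /=.
by rewrite diff_val scale1r.
Qed.

Lemma MVT_line h y u t : 0 < t ->
  (forall s, 0 <= s <= t -> differentiable h (y + s *: u)) ->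
  exists2 s, 0 <= s <= t & h (y + t *: u) - h y = 'd h (y + s *: u) u * t.
Proof.
move=> t0 dh.
have [||s st e] := @MVT R (fun r => h (y + r *: u))
  (fun s => 'd h (y + s *: u) u) 0 t t0.
- move=> s /[!in_itv]/= /andP[s0 st]; apply: is_derive_line; apply: dh.
  by rewrite !ltW.
- apply: derivable_within_continuous => s /[!in_itv]/= st.
  by have [] := is_derive_line (dh s st).
exists s; first by move: st; rewrite in_itv /= => /andP[? ?]; rewrite !ltW.
by move: e; rewrite scale0r addr0 subr0.
Qed.

(** Two applications of the mean value theorem: one to y |-> h (y + t v) - h y
    along u, one to y |-> 'd h y u along v. The left-hand side is symmetric in
    u and v. *)
Lemma second_difference A h x u v t : C_on 2 A h -> 0 < t ->
  (forall s r, 0 <= s <= t -> 0 <= r <= t -> A (x + s *: u + r *: v)) ->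
  exists s r, [/\ 0 <= s <= t, 0 <= r <= t &
    h (x + t *: u + t *: v) - h (x + t *: u) - h (x + t *: v) + h x =
    'd (fun y => 'd h y u) (x + s *: u + r *: v) v * t ^+ 2].
Proof.
move=> [dh /(_ u)[ddh _]] t0 At.
have t01 : 0 <= t <= t by rewrite (ltW t0) lexx.
have t00 : 0 <= (0 : R) <= t by rewrite (ltW t0) lexx.
pose w := t *: v.
pose g y := h (y + w) - h y.
have dgx s : 0 <= s <= t ->
    is_diff (x + s *: u) g
      (fun z => 'd h (x + s *: u + w) z - 'd h (x + s *: u) z).
  move=> st.
  have A1 := At s t st t01; have A2 := At s 0 st t00.
  rewrite scale0r addr0 in A2.
  have ds := is_diff_shift (x + s *: u) w.
  have d1 : is_diff (x + s *: u) (fun y => h (y + w)) ('d h (x + s *: u + w)).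
    by apply: is_diff_comp; exact/differentiableP/dh.
  exact: (is_diffB d1 (differentiableP (dh _ A2))).
have [s st e1] : exists2 s, 0 <= s <= t &
    g (x + t *: u) - g x = 'd g (x + s *: u) u * t.
  apply: (MVT_line t0) => r rt; have dr := dgx r rt.
  exact: (ex_diff (is_diff_def := dr)).
have /(congr1 (@^~ u)) e2 := diff_val (is_diff_def := dgx s st).
have [r rt e3] : exists2 r, 0 <= r <= t &
    'd h (x + s *: u + w) u - 'd h (x + s *: u) u =
    'd (fun y => 'd h y u) (x + s *: u + r *: v) v * t.
  apply: (@MVT_line (fun y => 'd h y u) _ v t t0) => r rt.
  by apply: ddh; apply: At.
exists s, r; split => //.
rewrite expr2 mulrA -e3.
transitivity ('d g (x + s *: u) u * t); last by congr (_ * t); exact: e2.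
by rewrite -e1 /g /w; ring.
Qed.

(** Exchanging u and v in the second difference gives, in every ball around x, a
    value of one mixed derivative equal to a value of the other. If the two
    differed at x, this would contradict their continuity. *)
Theorem schwarz A h x u v : open A -> A x -> C_on 2 A h ->
  'd (fun y => 'd h y v) x u = 'd (fun y => 'd h y u) x v.
Proof.
move=> oA Ax Ch.
pose P := fun y => 'd (fun y => 'd h y v) y u.
pose Q := fun y => 'd (fun y => 'd h y u) y v.
have cP : {for x, continuous P} by case: Ch => _ /(_ v)[_ /(_ u)]; apply.
have cQ : {for x, continuous Q} by case: Ch => _ /(_ u)[_ /(_ v)]; apply.
suff : P x = Q x by [].
apply/eqP; apply: contraT => PQ.
pose e := `|P x - Q x| / 2.
have e0 : 0 < e by rewrite divr_gt0 // normr_gt0 subr_eq0.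
have Px : \forall y \near x, `|P x - P y| < e.
  by move/cvgrPdist_lt: cP; apply.
have Qx : \forall y \near x, `|Q x - Q y| < e.
  by move/cvgrPdist_lt: cQ; apply.
have nA : \forall y \near x, A y by exact: open_nbhs_nbhs.
have /nbhs_ballP[r /= r0 near_x] : \forall y \near x,
    [/\ A y, `|P x - P y| < e & `|Q x - Q y| < e].
  by near=> y; split; near: y.
pose c := `|u| + `|v| + 1.
have c0 : 0 < c by rewrite ltr_wpDl // addr_ge0.
pose t := r / c.
have t0 : 0 < t by rewrite divr_gt0.
(* By the choice of t, the parallelogram with vertex x and sides t u, t v lies
   in the ball; a and b stand for u and v in either order. *)
have inball a b (p q : R) : `|a| + `|b| + 1 = c -> 0 <= p <= t -> 0 <= q <= t ->
    ball x r (x + p *: a + q *: b).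
  move=> abc /andP[p0 pt] /andP[q0 qt]; rewrite -ball_normE /= -addrA opprD.
  rewrite addNKr normrN (le_lt_trans (ler_normD _ _)) // !normrZ.
  rewrite (ger0_norm p0) (ger0_norm q0).
  rewrite (@le_lt_trans _ _ (t * `|a| + t * `|b|)) //.
    by rewrite lerD // ler_wpM2r.
  rewrite -mulrDr /t -mulrA gtr_pMr // mulrC ltr_pdivrMr // mul1r -abc.
  by rewrite ltrDl.
have [s [q [sb qb E1]]] := @second_difference A h x u v t Ch t0
  (fun s q sb qb => let: And3 a _ _ := near_x _ (inball u v s q erefl sb qb) in a).
have c' : `|v| + `|u| + 1 = c by rewrite [`|v| + _]addrC.
have [s' [q' [sb' qb' E2]]] := @second_difference A h x v u t Ch t0
  (fun s q sb qb => let: And3 a _ _ := near_x _ (inball v u s q c' sb qb) in a).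
have [_ _ Q1] := near_x _ (inball u v s q erefl sb qb).
have [_ P1 _] := near_x _ (inball v u s' q' c' sb' qb').
have PQ' : P (x + s' *: v + q' *: u) = Q (x + s *: u + q *: v).
  apply: (@mulIf _ (t ^+ 2)); first by rewrite expf_neq0 // gt_eqF.
  rewrite /P /Q -E1 -E2 -!addrA [t *: v + t *: u]addrC; ring.
move: P1 Q1; rewrite PQ'; move: (Q (x + _ + _)) => z P1 Q1.
have : `|P x - Q x| < e + e.
  by rewrite (le_lt_trans (ler_distD z _ _)) // ltrD // (distrC z).
by rewrite /e -splitr ltxx.
Unshelve. all: by end_near. Qed.

Lemma diff_entry m (h : 'rV[R]_d -> 'rV[R]_m) x v k : differentiable h x ->
  'd (entry k \o h) x v = entry k ('d h x v).
Proof.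
move=> dh; have ck := @entry_continuous R m k.
have dk := linear_differentiable (h x) ck.
by rewrite (diff_comp dh dk) /= diff_lin.
Qed.

Lemma schwarz_row A m (h : 'rV[R]_d -> 'rV[R]_m) x u v : open A -> A x ->
  C_on 2 A h -> 'd (fun y => 'd h y v) x u = 'd (fun y => 'd h y u) x v.
Proof.
move=> oA Ax Ch; apply/rowP => k; rewrite -![_ 0 k]/(entry k _).
have [dh ddh] := Ch.
have swap w w' : entry k ('d (fun y => 'd h y w) x w') =
    'd (fun y => 'd (entry k \o h) y w) x w'.
  have [dhw _] := ddh w.
  rewrite -(diff_entry _ _ (dhw x Ax)).
  have dkh : differentiable (fun y => 'd (entry k \o h) y w) x.
    have [_ /(_ w)[dkhw _]] := C_on_linear oA (@entry_continuous R m k) Ch.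
    exact: dkhw.
  have e y : A y -> 'd (entry k \o h) y w = (entry k \o (fun y => 'd h y w)) y.
    by move=> Ay; rewrite diff_entry //; apply: dh.
  have e' := diff_val (is_diff_def := open_eq_is_diff oA Ax e dkh).
  exact: (congr1 (@^~ w') e').
rewrite !swap; apply: (schwarz _ _ oA Ax).
exact: C_on_linear oA (@entry_continuous R m k) Ch.
Qed.

End Schwarz.

(** * Exterior forms of top degree *)

Section ExteriorForms.
Variables (R : realType) (d : nat).
Implicit Types (k l : nat) (u x y : 'rV[R]_d).

Definition upd k (v : 'I_k -> 'rV[R]_d) (j : 'I_k) x : 'I_k -> 'rV[R]_d :=
  fun i => if i == j then x else v i.

Definition multilinear k (h : kform R d k) :=
  forall v j (a : R) x y,
    h (upd v j (a *: x + y)) = a * h (upd v j x) + h (upd v j y).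

Definition alternating k (h : kform R d k) :=
  forall v i j, i != j -> v i = v j -> h v = 0.

Definition killed_by u k (h : kform R d k) := forall v j, v j = u -> h v = 0.

Lemma upd_id k (v : 'I_k -> 'rV[R]_d) j : upd v j (v j) = v.
Proof. by apply/funext => i; rewrite /upd; case: eqP => [->|]. Qed.

Lemma upd_comp k m (f : 'I_m -> 'I_k) v j x i : injective f -> f i = j ->
  (fun i' => upd v j x (f i')) = upd (fun i' => v (f i')) i x.
Proof.
move=> fI <-; apply/funext => i'; rewrite /upd.
by rewrite (inj_eq fI).
Qed.

Lemma upd_comp_out k m (f : 'I_m -> 'I_k) v j x : (forall i, f i != j) ->
  (fun i' => upd v j x (f i')) = (fun i' => v (f i')).
Proof. by move=> fj; apply/funext => i'; rewrite /upd (negPf (fj i')). Qed.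

(** In each term of the antisymmetrization a given argument goes to exactly one
    of the two factors. *)
Lemma multilinear_wedge k l (w : kform R d k) (h : kform R d l) :
  multilinear w -> multilinear h -> multilinear (wedge w h).
Proof.
move=> mw mh v j a x y; rewrite /wedge mulrCA -mulrDr; congr (_ * _).
rewrite mulr_sumr -big_split /=; apply: eq_bigr => s _.
have lI : injective (fun i => s (lshift l i)).
  by move=> i i' /perm_inj/lshift_inj.
have rI : injective (fun i => s (rshift k i)).
  by move=> i i' /perm_inj/rshift_inj.
have [i si] : exists i, s i = j by exists ((s^-1)%g j); rewrite permKV.
case: (split_ordP i) si => i0 -> si.
  have out i' : s (rshift k i') != j.
    by rewrite -si (inj_eq perm_inj) eq_rlshift.
  have wE z : w (fun i => upd v j z (s (lshift l i))) =
      w (upd (fun i => v (s (lshift l i))) i0 z).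
    by congr (w _); exact: upd_comp si.
  have hE z : h (fun i => upd v j z (s (rshift k i))) =
      h (fun i => v (s (rshift k i))).
    by congr (h _); exact: upd_comp_out out.
  rewrite (wE (a *: x + y)) (wE x) (wE y) (hE (a *: x + y)) (hE x) (hE y) mw.
move: (w (upd _ _ x)) (w (upd _ _ y)) (h _) ((-1) ^+ s : R) => p q r e; ring.
have out i' : s (lshift l i') != j.
  by rewrite -si (inj_eq perm_inj) eq_lrshift.
have wE z : w (fun i => upd v j z (s (lshift l i))) =
    w (fun i => v (s (lshift l i))).
  by congr (w _); exact: upd_comp_out out.
have hE z : h (fun i => upd v j z (s (rshift k i))) =
    h (upd (fun i => v (s (rshift k i))) i0 z).
  by congr (h _); exact: upd_comp si.
rewrite (wE (a *: x + y)) (wE x) (wE y) (hE (a *: x + y)) (hE x) (hE y) mh.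
move: (h (upd _ _ x)) (h (upd _ _ y)) (w _) ((-1) ^+ s : R) => p q r e; ring.
Qed.

Lemma killed_by_wedge u k l (w : kform R d k) (h : kform R d l) :
  killed_by u w -> killed_by u h -> killed_by u (wedge w h).
Proof.
move=> kw kh v j vj; rewrite /wedge big1 ?mulr0 // => s _.
have [i si] : exists i, s i = j by exists ((s^-1)%g j); rewrite permKV.
case: (split_ordP i) si => i0 -> si.
  by rewrite (kw _ i0) ?si // mul0r mulr0.
by rewrite (kh _ i0) ?si // !mulr0.
Qed.

(** The antisymmetrization built into the wedge makes it alternating whatever
    the factors are: composing with the transposition of the two equal arguments
    maps the sum to its opposite. *)
Lemma alternating_wedge k l (w : kform R d k) (h : kform R d l) :
  alternating (wedge w h).
Proof.
move=> v i j ij vij; rewrite /wedge; set S := \sum_s _.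
suff /eqP : S = - S.
  by rewrite -addr_eq0 -mulr2n mulrn_eq0 /= => /eqP ->; rewrite mulr0.
rewrite {1}/S (reindex_inj (mulIg (tperm i j))) /= -sumrN; apply: eq_bigr => s _.
have vt z : v ((s * tperm i j)%g z) = v (s z).
  by rewrite permM; case: tpermP => // ->.
under [fun i0 => v _]funext => z do rewrite vt.
under [fun i0 => v ((s * _)%g (rshift _ _))]funext => z do rewrite vt.
by rewrite odd_permM odd_tperm ij addbT signrN mulNr.
Qed.

Lemma multilinear_form1 (a : 'rV[R]_d -> R) : linear a -> multilinear (form1 a).
Proof. by move=> la v j b x y; rewrite /form1 /upd (ord1 j) eqxx la. Qed.

Lemma multilinear_form2 (w : 'rV[R]_d -> 'rV[R]_d -> R) :
  (forall y, linear (w^~ y)) -> (forall x, linear (w x)) ->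
  multilinear (form2 w).
Proof.
move=> wl wr v j b x y; rewrite /form2 /upd.
have [->|j0] := eqVneq j ord0; first by rewrite /= wl.
have -> : j = ord_max by apply/val_inj; case: j j0 => [[|[|//]]].
by rewrite /= wr.
Qed.

Lemma multilinear_wedge_pow n (w : kform R d 2) :
  multilinear w -> multilinear (wedge_pow n w).
Proof.
move=> mw; elim: n => [|n IH] /=; first by move=> v [].
exact: multilinear_wedge.
Qed.

Lemma killed_by_wedge_pow u n (w : kform R d 2) :
  killed_by u w -> killed_by u (wedge_pow n w).
Proof.
move=> kw; elim: n => [|n IH] /=; first by move=> v [].
exact: killed_by_wedge.
Qed.

Lemma multilinear_comb k (h : kform R d k) v (c : 'I_k -> R) j :
  multilinear h -> alternating h ->
  h (upd v j (\sum_i c i *: v i)) = c j * h v.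
Proof.
move=> mh ah.
have h0 : h (upd v j 0) = 0.
  have := mh v j 1 0 0; rewrite scaler0 addr0 mul1r => /eqP.
  by rewrite -subr_eq0 opprD addNKr oppr_eq0 => /eqP.
have -> : h (upd v j (\sum_i c i *: v i)) = \sum_i c i * h (upd v j (v i)).
  have hD z1 z2 : h (upd v j (z1 + z2)) = h (upd v j z1) + h (upd v j z2).
    by have := mh v j 1 z1 z2; rewrite scale1r mul1r.
  rewrite (big_morph (fun z => h (upd v j z)) hD h0); apply: eq_bigr => i _.
  by have := mh v j (c i) (v i) 0; rewrite h0 !addr0.
rewrite (bigD1 j) //= upd_id big1 ?addr0 // => i ij.
by rewrite (ah _ i j ij) ?mulr0 // /upd (negPf ij) eqxx.
Qed.

(** Among the k = d vectors v_i and u there is a relation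
    sum_i c_i v_i = u or 0 with c nonzero: either the v_i form a basis, or they
    are dependent. Replacing v_j, with c_j nonzero, by this combination
    multiplies the value of h by c_j and also makes it vanish. *)
Lemma top_form_killed u k (h : kform R d k) : k = d -> u != 0 ->
  multilinear h -> alternating h -> killed_by u h -> forall v, h v = 0.
Proof.
move=> kd u0 mh ah kh v; pose V := \matrix_(i < k) v i.
have [c c0 cV] : exists2 c : 'rV_k, c != 0 & c *m V = u \/ c *m V = 0.
  have [fV|] := boolP (row_free V).
    have /submxP[c uE] : (u <= V)%MS.
      by apply: submx_full; rewrite /row_full (eqP fV) kd.
    exists c; last by left.
    by apply: contraNneq u0 => c0; rewrite uE c0 mul0mx.
  rewrite -kermx_eq0 => /rowV0Pn[c /sub_kermxP cV c0].
  by exists c => //; right.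
have [j cj] : exists j, c 0 j != 0.
  by apply/existsP; apply: contraNT c0 => /existsPn c0; apply/eqP/rowP => j;
     rewrite mxE; apply/eqP; rewrite -[_ == _]negbK; exact: c0.
have := multilinear_comb v (fun i => c 0 i) j mh ah.
have -> : \sum_i c 0 i *: v i = c *m V.
  rewrite mulmx_sum_row; apply: eq_bigr => i _; by rewrite rowK.
suff -> : h (upd v j (c *m V)) = 0.
  by move/esym/eqP; rewrite mulf_eq0 (negPf cj) => /eqP.
case: cV => ->; first by apply: (kh _ j); rewrite /upd eqxx.
by have := mh v j (-1) 0 0; rewrite scaler0 addr0 mulN1r addNr.
Qed.

End ExteriorForms.

(** * Bilinear forms and the pointwise contact condition *)

Section BilinearForms.
Variables (R : realType) (d : nat).
Implicit Types (u v x y : 'rV[R]_d) (b w : 'rV[R]_d -> 'rV[R]_d -> R).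

Lemma linear_expand_fun (f : 'rV[R]_d -> R) v : linear f ->
  f v = \sum_(k < d) v 0 k * f (delta_mx 0 k).
Proof.
move=> lf; pose fM := GRing.isLinear.Build _ _ _ _ _ lf.
pose fL : {linear 'rV[R]_d -> R} := HB.pack f fM.
exact: (linear_expand fL).
Qed.

Definition is_bilinear b :=
  (forall y, linear (b^~ y)) /\ (forall x, linear (b x)).

Definition is_nondegenerate b := forall u, (forall v, b u v = 0) -> u = 0.

Definition gram b : 'M[R]_d := \matrix_(i, j) b (delta_mx 0 i) (delta_mx 0 j).

Lemma mul_gram b u j : is_bilinear b -> (u *m gram b) 0 j = b u (delta_mx 0 j).
Proof.
move=> [bl _]; rewrite mxE (linear_expand_fun u (bl (delta_mx 0 j))).
by apply: eq_bigr => i _; rewrite mxE.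
Qed.

Lemma mul_gram_eq0 b u : is_bilinear b -> u *m gram b = 0 -> forall v, b u v = 0.
Proof.
move=> bb ub v; rewrite (linear_expand_fun v (bb.2 u)) big1 // => j _.
by rewrite -mul_gram // ub mxE mulr0.
Qed.

Lemma singular_kernel (B : 'M[R]_d) : B \notin unitmx ->
  exists2 u : 'rV_d, u != 0 & u *m B = 0.
Proof.
rewrite -row_free_unit -kermx_eq0 => /rowV0Pn[u /sub_kermxP uB u0].
by exists u.
Qed.

Lemma gram_unit b : is_bilinear b -> is_nondegenerate b -> gram b \in unitmx.
Proof.
move=> bb nb; apply: contraT => /singular_kernel[u u0 /(mul_gram_eq0 bb)/nb uE].
by rewrite uE eqxx in u0.
Qed.

Definition solve b (beta : 'rV[R]_d -> R) : 'rV[R]_d :=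
  (\row_j beta (delta_mx 0 j)) *m invmx (gram b).

Lemma solveP b beta v : is_bilinear b -> is_nondegenerate b -> linear beta ->
  b (solve b beta) v = beta v.
Proof.
move=> bb nb lb; rewrite (linear_expand_fun v (bb.2 _)) (linear_expand_fun v lb).
apply: eq_bigr => j _; congr (_ * _).
by rewrite -mul_gram // mulmxKV ?gram_unit // mxE.
Qed.

Lemma solve_unique b (beta : 'rV[R]_d -> R) u : is_bilinear b ->
  is_nondegenerate b -> (forall v, b u v = beta v) -> u = solve b beta.
Proof.
move=> bb nb ub; rewrite -(mulmxK (gram_unit bb nb) u); congr (_ *m _).
by apply/rowP => j; rewrite mul_gram // mxE.
Qed.

(** A skew-symmetric matrix equals minus its transpose, so in odd size its
    determinant is its own opposite. *)
Lemma odd_skew_kernel w : odd d -> is_bilinear w ->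
  (forall x y, w x y = - w y x) -> exists2 k, k != 0 & forall v, w k v = 0.
Proof.
move=> od bw sw.
have [|u u0 /(mul_gram_eq0 bw) uw] := @singular_kernel (gram w); last by exists u.
have : \det (gram w) = - \det (gram w).
  rewrite -{1}det_tr; have -> : (gram w)^T = -1 *: gram w.
    by apply/matrixP => i j; rewrite !mxE sw mulN1r.
  by rewrite detZ -signr_odd od expr1 mulN1r.
move/eqP; rewrite -addr_eq0 -mulr2n mulrn_eq0 /= => dw.
by rewrite unitmxE unitfE dw.
Qed.

End BilinearForms.

Section PointwiseContact.
Variables (R : realType) (n : nat).
Local Notation V := 'rV[R]_(2 * n).+1.
Variables (a : V -> R) (w : V -> V -> R).
Hypotheses (la : linear a) (bw : is_bilinear w) (sw : forall x y, w x y = - w y x).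

(** The form B = dalpha + alpha (x) alpha at one point. Although not symmetric,
    it plays the part of a Riemannian metric: it identifies vectors with linear
    forms, and it merges the two conditions that define the Reeb and contact
    Hamiltonian fields, on alpha(X) and on dalpha(X, .), into one regular linear
    system. *)
Definition metric : V -> V -> R := fun x y => w x y + a x * a y.

Lemma skew_diag x : w x x = 0.
Proof. by have /eqP := sw x x; rewrite -addr_eq0 -mulr2n mulrn_eq0 => /eqP. Qed.

Lemma metric_bilinear : is_bilinear metric.
Proof.
have [bl br] := bw; split=> y c u v; rewrite /metric.
  rewrite bl la; move: (w u y) (w v y) (a u) (a v) (a y) => p q r s t.
  by rewrite /GRing.scale /=; ring.
rewrite br la; move: (w y u) (w y v) (a u) (a v) (a y) => p q r s t.
by rewrite /GRing.scale /=; ring.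
Qed.

(** As w is skew, B(u, u) = a(u)^2, so a vector of the kernel of B is in the
    kernels of both a and w, and then it kills the top form. *)
Lemma metric_nondegenerate v :
  wedge (form1 a) (wedge_pow n (form2 w)) v != 0 -> is_nondegenerate metric.
Proof.
move=> nz u ku; apply: contraNeq nz => u0.
have au : a u = 0.
  have /eqP := ku u; rewrite /metric skew_diag add0r.
  by rewrite mulf_eq0 orbb => /eqP.
have wu y : w u y = 0 by have := ku y; rewrite /metric au mul0r addr0.
apply/eqP; apply: (top_form_killed _ u0).
- by rewrite add1n mulnC.
- apply: multilinear_wedge; first exact: multilinear_form1 la.
  by apply: multilinear_wedge_pow; case: bw; exact: multilinear_form2.
- exact: alternating_wedge.
- apply: killed_by_wedge.
    by move=> x j; rewrite /form1 (ord1 j) => ->.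
  apply: killed_by_wedge_pow => x j; rewrite /form2.
  have [->|j0] := eqVneq j ord0; first by move=> ->.
  have -> : j = ord_max by apply/val_inj; case: j j0 => [[|[|//]]].
  by move=> ->; rewrite sw wu oppr0.
Qed.

(** Test the equation B(u, .) = a against a kernel vector k of w, which exists
    in odd dimension: it reads a(u) a(k) = a(k), and a(k) is nonzero because B
    is nondegenerate. *)
Lemma metric_reeb u : is_nondegenerate metric -> (forall v, metric u v = a v) ->
  a u = 1 /\ forall v, w u v = 0.
Proof.
move=> nd uP; suff au : a u = 1.
  by split=> // v; have /eqP := uP v; rewrite /metric au mul1r -subr_eq0 addrK => /eqP.
have [|k k0 wk] := odd_skew_kernel _ bw sw; first by rewrite /= mul2n odd_double.
have ak : a k != 0.
  apply: contraNneq k0 => ak; apply/eqP/nd => v.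
  by rewrite /metric wk ak mul0r addr0.
by apply: (mulIf ak); rewrite mul1r -[RHS]uP /metric sw wk oppr0 add0r.
Qed.

End PointwiseContact.

(** * Differentiating a family of linear forms *)

Section Sums.
Variables (R : realType) (U : normedModType R).

Lemma differentiable_sum_fun n (f : 'I_n -> U -> R) x :
  (forall i, differentiable (f i) x) ->
  differentiable (fun y => \sum_i f i y) x.
Proof.
move=> df; have -> : (fun y => \sum_i f i y) = \sum_i f i.
  by apply/funext => y; rewrite fct_sumE.
exact: differentiable_sum.
Qed.

Lemma diff_sum_fun n (f : 'I_n -> U -> R) x u :
  (forall i, differentiable (f i) x) ->
  'd (fun y => \sum_i f i y) x u = \sum_i 'd (f i) x u.
Proof.
move=> df; have dS := differentiable_sum_fun df.
rewrite -(deriveE u dS).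
have -> : (fun y => \sum_i f i y) = \sum_i f i.
  by apply/funext => y; rewrite fct_sumE.
rewrite derive_sum => [|i]; last exact: diff_derivable.
by apply: eq_bigr => i _; rewrite deriveE.
Qed.

End Sums.

(** For F y w linear in w, the derivative of y |-> F (phi y) (psi y) is computed
    by expanding psi y in the canonical basis. It serves twice: with phi a
    transition map for the covariance of dalpha, and with phi the identity for
    the formula of Cartan. *)
Section FamiliesOfForms.
Variables (R : realType) (m d : nat).
Local Notation U := 'rV[R]_m.
Variables (F : 'rV[R]_d -> 'rV[R]_d -> R) (phi psi : U -> 'rV[R]_d) (x : U).
Hypothesis F_linear : forall y, linear (F y).
Hypothesis F_diff : forall w, differentiable (F^~ w) (phi x).
Hypotheses (phi_diff : differentiable phi x) (psi_diff : differentiable psi x).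

Let term k := (entry k \o psi) * (F^~ (delta_mx 0 k) \o phi).

Let entry_psi_diff k : differentiable (entry k \o psi) x.
Proof.
apply: (differentiable_comp psi_diff).
exact: (linear_differentiable (psi x) (@entry_continuous R d k)).
Qed.

Let F_phi_diff k : differentiable (F^~ (delta_mx 0 k) \o phi) x.
Proof. exact: (differentiable_comp phi_diff (F_diff _)). Qed.

Let expand : (fun y => F (phi y) (psi y)) = fun y => \sum_k term k y.
Proof.
by apply/funext => y; rewrite (linear_expand_fun (psi y) (F_linear (phi y))).
Qed.

Let term_diff k : differentiable (term k) x.
Proof. exact: (differentiableM (entry_psi_diff k) (F_phi_diff k)). Qed.

Lemma family_differentiable : differentiable (fun y => F (phi y) (psi y)) x.
Proof. by rewrite expand; exact: differentiable_sum_fun. Qed.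

Lemma family_diff u : 'd (fun y => F (phi y) (psi y)) x u =
  'd (F^~ (psi x)) (phi x) ('d phi x u) + F (phi x) ('d psi x u).
Proof.
rewrite expand (diff_sum_fun u term_diff).
have -> : 'd (F^~ (psi x)) (phi x) ('d phi x u) =
    \sum_k psi x 0 k * 'd (F^~ (delta_mx 0 k)) (phi x) ('d phi x u).
  have -> : F^~ (psi x) = fun y => \sum_k psi x 0 k * F y (delta_mx 0 k).
    by apply/funext => y; rewrite (linear_expand_fun (psi x) (F_linear y)).
  have dF k : differentiable (F^~ (delta_mx 0 k)) (phi x) by exact: F_diff.
  rewrite (@diff_sum_fun _ _ _ (fun k y => psi x 0 k * F y (delta_mx 0 k))).
    2: by move=> k; exact: (differentiableZ _ (dF k)).
  apply: eq_bigr => k _.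
  exact: (congr1 (@^~ _) (diffZ (psi x 0 k) (dF k))).
rewrite (linear_expand_fun ('d psi x u) (F_linear (phi x))) -big_split /=.
apply: eq_bigr => k _.
have E : 'd (term k) x u = psi x 0 k *: 'd (F^~ (delta_mx 0 k) \o phi) x u +
    F (phi x) (delta_mx 0 k) *: 'd (entry k \o psi) x u :=
  congr1 (@^~ u) (diffM (entry_psi_diff k) (F_phi_diff k)).
rewrite E (diff_comp phi_diff (F_diff _)) diff_entry //.
by congr (_ + _); rewrite mulrC.
Qed.

End FamiliesOfForms.

(** * Changes of charts *)

Section Charts.
Variables (R : realType) (d : nat) (M : manifold R d).
Implicit Types (p : M) (i j k : index M) (u v : 'rV[R]_d).

Definition overlap i j := coord i @` (dom i `&` dom j).

Lemma overlapP i j p : dom i p -> dom j p -> overlap i j (coord i p).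
Proof. by move=> ip jp; exists p. Qed.

Lemma mem_img i p : dom i p -> img i (coord i p).
Proof. by move=> ip; exists p. Qed.

Lemma overlap_open i j : open (overlap i j).
Proof.
rewrite openE => _ [p [ip jp] <-].
have n1 : \forall y \near coord i p, img i y.
  by apply: open_nbhs_nbhs; split; [exact: img_open|exists p].
have n2 : \forall y \near coord i p, dom j (param i y).
  apply: (param_continuous ip); rewrite coordK //.
  by apply: open_nbhs_nbhs; split; [exact: dom_open|].
rewrite /interior.
near=> y; have [q iq qy] : img i y by near: y.
exists q => //; split => //.
by rewrite -(coordK iq) qy; near: y.
Unshelve. all: by end_near. Qed.

Lemma transition_differentiable i j p : dom i p -> dom j p ->
  differentiable (coord j \o param i) (coord i p).
Proof.
move=> ip jp; have [df _] := @transition_smooth R d M i j 1.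
exact: df (overlapP ip jp).
Qed.

Lemma transition_coord i j p : dom i p -> (coord j \o param i) (coord i p) = coord j p.
Proof. by move=> ip /=; rewrite coordK. Qed.

Lemma tchange_id i p v : dom i p -> tchange i i p v = v.
Proof.
move=> ip; rewrite /tchange.
have e y : img i y -> y = (coord i \o param i) y.
  by move=> [q iq <-] /=; rewrite coordK.
have did := is_diff_id (coord i p).
apply: etrans (congr1 (@^~ v) (diff_val (is_diff_def := did))).
exact: (open_eq_diff v (@img_open _ _ M i) (mem_img ip) e
  (ex_diff (is_diff_def := did))).
Qed.

(** The cocycle condition, by the chain rule on the overlap of the charts. *)
Lemma tchange_comp i j k p v : dom i p -> dom j p -> dom k p ->
  tchange j k p (tchange i j p v) = tchange i k p v.
Proof.
move=> ip jp kp; rewrite /tchange.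
have dij := transition_differentiable ip jp.
have djk := transition_differentiable jp kp.
have e y : overlap i j y ->
    ((coord k \o param j) \o (coord j \o param i)) y = (coord k \o param i) y.
  by move=> [q [iq jq] <-] /=; rewrite !coordK.
have phip := transition_coord j ip.
symmetry; apply: etrans (chain_rule phip dij djk v).
exact: (open_eq_diff v (@overlap_open i j) (overlapP ip jp) e
  (chain_differentiable phip dij djk)).
Qed.

Lemma tchangeK i j p v : dom i p -> dom j p ->
  tchange j i p (tchange i j p v) = v.
Proof. by move=> ip jp; rewrite tchange_comp // tchange_id. Qed.

Lemma dfun_chart (f : M -> R) i p v : smooth_fun f -> dom i p ->
  dfun f p v = 'd (f \o param i) (coord i p) (tchange (chart_at p) i p v).
Proof.
move=> sf ip; rewrite /dfun /tchange; set j := chart_at p.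
have jp : dom j p := chart_atP p.
have dji := transition_differentiable jp ip.
have df : differentiable (f \o param i) (coord i p).
  by have [dfi _] := sf i 1%N; exact: dfi (mem_img ip).
have e y : overlap j i y ->
    ((f \o param i) \o (coord i \o param j)) y = (f \o param j) y.
  by move=> [q [jq iq] <-] /=; rewrite !coordK.
have phip := transition_coord i jp.
apply: etrans (chain_rule phip dji df v).
exact: (open_eq_diff v (@overlap_open j i) (overlapP jp ip) e
  (chain_differentiable phip dji df)).
Qed.

Variable a : oneform M.

Lemma fcoordE i p v : dom i p ->
  fcoord a i (coord i p) v = a p (tchange i (chart_at p) p v).
Proof. by move=> ip; rewrite /fcoord coordK. Qed.

Lemma fcoord_center p v : fcoord a (chart_at p) (coord (chart_at p) p) v = a p v.
Proof. by have jp := chart_atP p; rewrite fcoordE // tchange_id. Qed.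

Lemma fcoord_change i j p v : dom i p -> dom j p ->
  fcoord a i (coord i p) v = fcoord a j (coord j p) (tchange i j p v).
Proof.
by move=> ip jp; rewrite !fcoordE // tchange_comp //; exact: chart_atP.
Qed.

Lemma fcoord_linear i x : linear (fcoord a i x).
Proof.
move=> c u v; rewrite /fcoord /tchange.
rewrite (linearP ('d (coord (chart_at (param i x)) \o param i)
  (coord i (param i x)))).
by rewrite linearP.
Qed.

Lemma vcoordE (X : vfield M) i p : dom i p ->
  vcoord X i (coord i p) = tchange (chart_at p) i p (X p).
Proof. by move=> ip; rewrite /vcoord coordK. Qed.

Lemma vcoord_center (X : vfield M) p :
  vcoord X (chart_at p) (coord (chart_at p) p) = X p.
Proof. by have jp := chart_atP p; rewrite vcoordE // tchange_id. Qed.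

Lemma fcoord_vcoord (X : vfield M) i p : dom i p ->
  fcoord a i (coord i p) (vcoord X i (coord i p)) = a p (X p).
Proof.
by move=> ip; have jp := chart_atP p; rewrite fcoordE // vcoordE // tchangeK.
Qed.

(** The exterior derivative read in an arbitrary chart; at x = coord i p with
    i = chart_at p it is convertible to [dform a p]. *)
Definition dchart i (x u v : 'rV[R]_d) : R :=
  'd (fcoord a i ^~ v) x u - 'd (fcoord a i ^~ u) x v.

Lemma dchart_skew i x u v : dchart i x u v = - dchart i x v u.
Proof. by rewrite /dchart opprB. Qed.

Hypothesis smooth_a : smooth_oneform a.

Lemma fcoord_differentiable i p v : dom i p ->
  differentiable (fcoord a i ^~ v) (coord i p).
Proof. by move=> ip; have [df _] := smooth_a i v 1%N; exact: df (mem_img ip). Qed.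

Lemma dchart_bilinear i p : dom i p -> is_bilinear (dchart i (coord i p)).
Proof.
move=> ip.
pose D w z := 'd (fcoord a i ^~ w) (coord i p) z.
have Dl c u v z : D (c *: u + v) z = c * D u z + D v z.
  have du := fcoord_differentiable u ip; have dv := fcoord_differentiable v ip.
  have dcu := differentiableZ c du; rewrite /D.
  have -> : fcoord a i ^~ (c *: u + v) = c *: fcoord a i ^~ u + fcoord a i ^~ v.
    by apply/funext => x; rewrite fcoord_linear.
  apply: (etrans (congr1 (@^~ z) (diffD dcu dv))); congr (_ + _).
  exact: (congr1 (@^~ z) (diffZ c du)).
have Dr c u v z : D z (c *: u + v) = c * D z u + D z v.
  exact: (linearP ('d (fcoord a i ^~ z) (coord i p))).
have br x : linear (dchart i (coord i p) x).
  move=> c u v.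
  change (D (c *: u + v) x - D x (c *: u + v) =
    c * (D u x - D x u) + (D v x - D x v)).
  rewrite Dl Dr; move: (D u x) (D x u) (D v x) (D x v) => r1 r2 r3 r4; ring.
split=> // y c u v; have E z := dchart_skew i (coord i p) z y.
by rewrite (E (c *: u + v)) (E u) (E v) br opprD -scalerN.
Qed.

(** Covariance of the exterior derivative. With phi the transition map, near x
    one has fcoord a i y w = fcoord a j (phi y) ('d phi y w). The derivative of
    the right-hand side along z is the expected term plus the value of
    fcoord a j on the second derivative of phi along w and z, which disappears
    after antisymmetrization. *)
Lemma dchart_change i j p u v : dom i p -> dom j p ->
  dchart i (coord i p) u v =
  dchart j (coord j p) (tchange i j p u) (tchange i j p v).
Proof.
move=> ip jp; set x := coord i p; pose phi := coord j \o param i.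
have Ax : overlap i j x := overlapP ip jp.
have oA := @overlap_open i j.
have sphi := @transition_smooth R d M i j.
have dphi : differentiable phi x := transition_differentiable ip jp.
have phix : phi x = coord j p := transition_coord _ ip.
have E w z : 'd (fcoord a i ^~ w) x z =
    'd (fcoord a j ^~ (tchange i j p w)) (coord j p) (tchange i j p z) +
    fcoord a j (coord j p) ('d (fun y => 'd phi y w) x z).
  have dpsi : differentiable (fun y => 'd phi y w) x.
    by have [_ /(_ w)[dw _]] := sphi 2%N; exact: dw.
  have dF w' : differentiable (fcoord a j ^~ w') (phi x).
    by rewrite phix; exact: fcoord_differentiable.
  have lF y : linear (fcoord a j y) by exact: fcoord_linear.
  have e y : overlap i j y -> fcoord a j (phi y) ('d phi y w) = fcoord a i y w.
    move=> [q [iq jq] <-]; rewrite (fcoord_change w iq jq) /phi /= coordK //.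
  rewrite -phix; apply: etrans (family_diff lF dF dphi dpsi z).
  exact: (open_eq_diff z oA Ax e (family_differentiable lF dF dphi dpsi)).
have sw := congr1 (fcoord a j (coord j p)) (schwarz_row u v oA Ax (sphi 2%N)).
have Ev := etrans (E v u) (congr1 (fun r => _ + r) sw).
apply: etrans (congr2 (fun r s => r - s) Ev (E u v)) _.
by rewrite opprD addrACA subrr addr0.
Qed.

End Charts.

(** * Duality between 1-forms and vector fields *)

Section Sharp.
Variables (R : realType) (n : nat) (M : manifold R (2 * n).+1).
Local Notation V := 'rV[R]_(2 * n).+1.
Variable alpha : oneform M.
Hypothesis contact : contact_form alpha.
Implicit Types (p : M) (i : index M) (u v : V).

Let smooth_alpha : smooth_oneform alpha := contact.1.

Definition chart_metric i (x : V) := metric (fcoord alpha i x) (dchart alpha i x).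

Lemma chart_metric_bilinear i p : dom i p ->
  is_bilinear (chart_metric i (coord i p)).
Proof.
move=> ip; apply: metric_bilinear; last exact: dchart_bilinear.
exact: fcoord_linear.
Qed.

Lemma chart_metric_change i j p u v : dom i p -> dom j p ->
  chart_metric i (coord i p) u v =
  chart_metric j (coord j p) (tchange i j p u) (tchange i j p v).
Proof.
move=> ip jp; rewrite /chart_metric /metric (dchart_change smooth_alpha _ _ ip jp).
by rewrite !(fcoord_change _ _ ip jp).
Qed.

(** The contact condition only concerns the preferred chart at p; the property
    is carried to the other charts by covariance. *)
Lemma chart_metric_nondegenerate i p : dom i p ->
  is_nondegenerate (chart_metric i (coord i p)).
Proof.
move=> ip; set j := chart_at p; have jp : dom j p := chart_atP p.
have nj : is_nondegenerate (chart_metric j (coord j p)).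
  have [v nv] := contact.2 p; apply: (@metric_nondegenerate _ _ _ _ _ _ _ v).
  - exact: fcoord_linear.
  - exact: dchart_bilinear.
  - by move=> x y; exact: dchart_skew.
  - have -> : fcoord alpha j (coord j p) = alpha p.
      by apply/funext => x; exact: fcoord_center.
    exact: nv.
move=> u uP; have Tu : tchange i j p u = 0.
  apply: nj => v; rewrite -[v](tchangeK _ jp ip) -chart_metric_change //.
by rewrite -[u](tchangeK _ ip jp) Tu /tchange linear0.
Qed.

Variable beta : oneform M.
Hypothesis smooth_beta : smooth_oneform beta.

Definition chart_sharp i (x : V) : V :=
  solve (chart_metric i x) (fcoord beta i x).

Definition sharp : vfield M :=
  fun p => chart_sharp (chart_at p) (coord (chart_at p) p).

Lemma sharpP p v :
  dform alpha p (sharp p) v + alpha p (sharp p) * alpha p v = beta p v.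
Proof.
have jp := chart_atP p.
have := @solveP _ _ _ _ v (chart_metric_bilinear jp)
  (chart_metric_nondegenerate jp)
  (@fcoord_linear _ _ _ beta (chart_at p) (coord (chart_at p) p)).
rewrite fcoord_center -[solve _ _]/(sharp p) /chart_metric /metric.
by rewrite !fcoord_center.
Qed.

(** The local solutions in all charts are the components of one vector field,
    by uniqueness of the solution and covariance of the system. *)
Lemma sharp_chart i p : dom i p ->
  vcoord sharp i (coord i p) = chart_sharp i (coord i p).
Proof.
move=> ip; set j := chart_at p; have jp : dom j p := chart_atP p.
apply: solve_unique.
- exact: chart_metric_bilinear.
- exact: chart_metric_nondegenerate.
move=> v; rewrite vcoordE // (chart_metric_change _ _ ip jp) tchangeK //.
rewrite /sharp /chart_sharp solveP.
- by rewrite (fcoord_change _ _ ip jp).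
- exact: chart_metric_bilinear.
- exact: chart_metric_nondegenerate.
- exact: fcoord_linear.
Qed.

Lemma smooth_sharp : smooth_vfield sharp.
Proof.
move=> i k; have oi := @img_open _ _ M i.
apply: (@C_on_ext _ _ _ _ _ (chart_sharp i)) => //.
  by move=> _ [p ip <-]; rewrite sharp_chart.
apply: C_on_solve => //.
- move=> _ [p ip <-]; apply: gram_unit.
    exact: chart_metric_bilinear.
  exact: chart_metric_nondegenerate.
- move=> j; under eq_fun do rewrite mxE.
  exact: smooth_beta.
move=> j l; under eq_fun do rewrite mxE.
have Ca u := smooth_alpha i u.
have Cd u v : C_on k (img i) (fun x => 'd (fcoord alpha i ^~ v) x u).
  by have [_] := Ca v k.+1; apply.
apply: C_onD => //; last exact: C_onM oi (Ca _ k) (Ca _ k).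
exact: C_onB oi (Cd _ _) (Cd _ _).
Qed.

End Sharp.

(** * Differentials of functions and the formula of Cartan *)

Section PairingDerivative.
Variables (R : realType) (d : nat) (M : manifold R d).
Implicit Types (p : M) (X : vfield M) (a : oneform M).

(** Derivative of the function alpha(X) = g by the product rule: the form varies
    with X frozen, then X varies with the form frozen. *)
Lemma dfun_pairing a X (g : M -> R) p v :
  smooth_oneform a -> smooth_vfield X -> (forall q, a q (X q) = g q) ->
  let i := chart_at p in
  dfun g p v = 'd (fcoord a i ^~ (X p)) (coord i p) v +
    a p ('d (vcoord X i) (coord i p) v).
Proof.
move=> sa sX aX i; have ip : dom i p := chart_atP p.
have oi := @img_open _ _ M i; have xi := mem_img ip.
have dX : differentiable (vcoord X i) (coord i p).
  by have [dX _] := sX i 1%N; exact: dX.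
have dF w : differentiable (fcoord a i ^~ w) (coord i p).
  exact: fcoord_differentiable.
have lF y : linear (fcoord a i y) by exact: fcoord_linear.
have did := is_diff_id (coord i p).
have E := family_diff lF dF (ex_diff (is_diff_def := did)) dX v.
have D := family_differentiable lF dF (ex_diff (is_diff_def := did)) dX.
have e y : img i y -> fcoord a i y (vcoord X i y) = (g \o param i) y.
  by move=> [q iq <-]; rewrite fcoord_vcoord // aX /= coordK.
have eid : 'd (fun y : 'rV[R]_d => y) (coord i p) v = v.
  exact: (congr1 (@^~ v) (diff_val (is_diff_def := did))).
have := open_eq_diff v oi xi e D.
move=> h; apply: etrans h _; apply: etrans E _.
have XE : vcoord X i (coord i p) = X p := vcoord_center X p.
have aE u : fcoord a i (coord i p) u = a p u := fcoord_center a p u.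
rewrite /= aE; congr (_ + _).
by rewrite XE; congr ('d _ _ _).
Qed.

(** The terms in which X and Y are frozen add up to da(X, Y). *)
Lemma cartan_formula a X Y (f g : M -> R) p :
  smooth_oneform a -> smooth_vfield X -> smooth_vfield Y ->
  (forall q, a q (X q) = f q) -> (forall q, a q (Y q) = g q) ->
  a p (lie X Y p) = dfun g p (X p) - dfun f p (Y p) - dform a p (X p) (Y p).
Proof.
move=> sa sX sY aX aY.
rewrite /lie (dfun_pairing _ _ sa sY aY) (dfun_pairing _ _ sa sX aX) /dform linearB.
have cancel (r1 r2 r3 r4 : R) : r1 - r2 = r3 + r1 - (r4 + r2) - (r3 - r4) by ring.
exact: cancel.
Qed.

Definition oneform_of (b : M -> 'rV[R]_d -> R) (lb : forall p, linear (b p)) :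
  oneform M := fun p =>
  HB.pack_for {scalar 'rV[R]_d} (b p) (GRing.isLinear.Build _ _ _ _ _ (lb p)).

Lemma dfun_linear (f : M -> R) p : linear (dfun f p).
Proof. by move=> c u v; rewrite /dfun linearP. Qed.

Lemma smooth_dfun (f : M -> R) (X : vfield M) : smooth_fun f ->
  smooth_vfield X -> smooth_fun (fun p => dfun f p (X p)).
Proof.
move=> sf sX i k; have oi := @img_open _ _ M i.
apply: (@C_on_ext _ _ _ _ _ (fun x => \sum_j entry j (vcoord X i x) *
    'd (f \o param i) x (delta_mx 0 j))) => //.
  move=> _ [p ip <-] /=; rewrite coordK // (dfun_chart _ sf ip) -vcoordE //.
  rewrite (linear_expand ('d (f \o param i) (coord i p))); exact: eq_bigr.
apply: C_on_sum => // j; apply: C_onM => //.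
  exact: C_on_linear oi (@entry_continuous R d j) (sX i k).
by have [_] := sf i k.+1; apply.
Qed.

Lemma smooth_funM (f g : M -> R) : smooth_fun f -> smooth_fun g ->
  smooth_fun (fun p => f p * g p).
Proof. by move=> sf sg i k; apply: C_onM; [exact: img_open|exact: sf|exact: sg]. Qed.

Lemma smooth_fun_cst (c : R) : smooth_fun (fun _ : M => c).
Proof. by move=> i k; apply: C_on_cst; exact: img_open. Qed.

Lemma smooth_chart_differentiable (f : M -> R) i p : smooth_fun f -> dom i p ->
  differentiable (f \o param i) (coord i p).
Proof. by move=> sf ip; have [df _] := sf i 1%N; exact: df (mem_img ip). Qed.

Lemma dfunM (f g : M -> R) p v : smooth_fun f -> smooth_fun g ->
  dfun (fun q => f q * g q) p v = f p * dfun g p v + g p * dfun f p v.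
Proof.
move=> sf sg; have ip := chart_atP p.
have df := smooth_chart_differentiable sf ip.
have dg := smooth_chart_differentiable sg ip.
apply: etrans (congr1 (@^~ v) (diffM df dg)) _.
have e (h : M -> R) : (h \o param (chart_at p)) (coord (chart_at p) p) = h p.
  by rewrite /= coordK.
exact: (congr2 (fun r s => r * dfun g p v + s * dfun f p v) (e f) (e g)).
Qed.

Lemma dfun_cst (c : R) p v : dfun (fun _ : M => c) p v = 0.
Proof. exact: (congr1 (@^~ v) (diff_cst _ _)). Qed.

End PairingDerivative.

(** * Reeb field, contact Hamiltonians and the Jacobi bracket *)

Section ContactHamiltonian.
Variables (R : realType) (n : nat) (M : manifold R (2 * n).+1).
Local Notation V := 'rV[R]_(2 * n).+1.
Variable alpha : oneform M.
Hypothesis contact : contact_form alpha.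
Implicit Types (p : M) (f g H : M -> R).

Let smooth_alpha : smooth_oneform alpha := contact.1.

Lemma dform_skew p u v : dform alpha p u v = - dform alpha p v u.
Proof. exact: dchart_skew. Qed.

(** The Reeb field is the dual of alpha itself. *)
Lemma reebP : is_reeb alpha (reeb alpha).
Proof.
apply: (@xgetPex _ _ [set X | is_reeb alpha X]).
have nd p : is_nondegenerate (metric (alpha p) (dform alpha p)).
  have [v nv] := contact.2 p; apply: (@metric_nondegenerate _ _ _ _ _ _ _ v nv).
  - by move=> c x y; rewrite linearP.
  - exact: (dchart_bilinear smooth_alpha (chart_atP p)).
  - exact: dform_skew.
have reeb_eq p : alpha p (sharp alpha alpha p) = 1 /\
    forall v, dform alpha p (sharp alpha alpha p) v = 0.
  apply: metric_reeb => //.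
  - exact: (dchart_bilinear smooth_alpha (chart_atP p)).
  - exact: dform_skew.
  - by move=> v; exact: (sharpP contact alpha p v).
exists (sharp alpha alpha); split=> [|p v|p].
- exact: smooth_sharp.
- exact: (reeb_eq p).2.
- exact: (reeb_eq p).1.
Qed.

(** The form whose dual is the contact Hamiltonian field of H: if alpha(X) = H,
    the condition on dalpha(X, .) is B(X, .) = (dH(R) + H) alpha - dH. *)
Definition hamiltonian_form H p (v : V) : R :=
  (dfun H p (reeb alpha p) + H p) * alpha p v - dfun H p v.

Lemma hamiltonian_form_linear H p : linear (hamiltonian_form H p).
Proof.
move=> c u v; rewrite /hamiltonian_form (dfun_linear H p c u v) linearP.
by rewrite /GRing.scale /=; ring.
Qed.

Lemma smooth_hamiltonian_form H : smooth_fun H ->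
  smooth_oneform (oneform_of (hamiltonian_form_linear H)).
Proof.
have [sR _ _] := reebP.
move=> sH i v k; have oi := @img_open _ _ M i.
apply: (@C_on_ext _ _ _ _ _ (fun x =>
  (((fun p => dfun H p (reeb alpha p)) \o param i) x + (H \o param i) x) *
    fcoord alpha i x v - 'd (H \o param i) x v)) => //.
  move=> _ [p ip <-]; rewrite !fcoordE //= coordK // /hamiltonian_form.
  by rewrite (dfun_chart (tchange _ _ _ v) sH ip) tchangeK //; exact: chart_atP.
apply: C_onB => //; last by have [_] := sH i k.+1; apply.
apply: C_onM => //; last exact: smooth_alpha.
by apply: C_onD => //; [exact: (smooth_dfun sH sR)|exact: sH].
Qed.

(** That the dual X satisfies alpha(X) = H is seen by testing its equation
    against the Reeb field, on which B(X, .) reduces to alpha(X) and the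
    right-hand side to H. *)
Lemma contact_hamiltonianP H : smooth_fun H ->
  is_contact_hamiltonian alpha H (contact_hamiltonian alpha H).
Proof.
move=> sH; apply: (@xgetPex _ _ [set X | is_contact_hamiltonian alpha H X]).
have [_ dR aR] := reebP.
pose X := sharp alpha (oneform_of (hamiltonian_form_linear H)).
have XP p v : dform alpha p (X p) v + alpha p (X p) * alpha p v =
    hamiltonian_form H p v by exact: (sharpP contact _ p v).
have aX p : alpha p (X p) = H p.
  have := XP p (reeb alpha p).
  rewrite dform_skew dR oppr0 add0r aR mulr1 => ->.
  by rewrite /hamiltonian_form aR mulr1 addrC addKr.
exists X; split=> [|p|p v]; [|exact: aX|].
  exact: (smooth_sharp contact (smooth_hamiltonian_form sH)).
have := XP p v; rewrite aX /hamiltonian_form => /(canRL (addrK _)) ->.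
move: (dfun H p _) (dfun H p _) (alpha p v) => r s t; ring.
Qed.

(** In the formula of Cartan, dalpha(X_f, X_g) is evaluated from the equation of
    X_g, not of X_f: the derivative of g along X_f then cancels. *)
Lemma jacobiE f g p : smooth_fun f -> smooth_fun g ->
  jacobi alpha f g p =
  f p * dfun g p (reeb alpha p) - dfun f p (contact_hamiltonian alpha g p).
Proof.
move=> sf sg; have [sX aX _] := contact_hamiltonianP sf.
have [sY aY dY] := contact_hamiltonianP sg.
rewrite /jacobi /pairing (cartan_formula _ smooth_alpha sX sY aX aY).
rewrite dform_skew dY aX.
move: (dfun g p _) (dfun g p _) (dfun f p _) => r s t; ring.
Qed.

End ContactHamiltonian.

Theorem proposition3p1p12 (R : realType) (n : nat) (M : manifold R (2 * n).+1)
    (alpha : oneform M) (f f' g : M -> R) :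
  contact_form alpha -> smooth_fun f -> smooth_fun f' -> smooth_fun g ->
  forall p : M,
    jacobi alpha (fun q => f q * f' q) g p =
      f p * jacobi alpha f' g p + f' p * jacobi alpha f g p
      - f p * f' p * jacobi alpha (fun=> 1) g p.
Proof.
move=> contact sf sf' sg p.
rewrite !jacobiE //; [|exact: smooth_fun_cst|exact: smooth_funM].
rewrite dfunM // dfun_cst.
move: (dfun g p _) (dfun f p _) (dfun f' p _) => r s t; ring.
Qed.
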